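(* Let $M$ be a compact metric space, $P$ a Markov Feller kernel on $M$, and $\mathcal{C}(M)\subset\mathcal{M}(M)$ a convex cone of measures which is a closed subset of some Banach space $(E,\|\cdot\|_E)$. Suppose that $P=Q+\Delta$ where $Q$ is a non-degenerate Feller sub-Markov kernel, $\Delta$ is a (possibly degenerate) sub-Markov kernel, $\mu Q\in\mathcal{C}(M)$ for every $\mu\in\mathcal{M}(M)$, and $\mu\Delta\in\mathcal{C}(M)$ for every $\mu\in\mathcal{C}(M)$. Assume furthermore that: (i) $\sum_{k\ge0}\|\mu\Delta^k\|_E<\infty$ for all $\mu\in\mathcal{C}(M)$; (ii) for every Borel set $A\subset M$, the map $\mathcal{C}(M)\to\mathbb{R}$, $\mu\mapsto\mu(A)$, is continuous when $\mathcal{C}(M)$ is equipped with the distance induced by $\|\cdot\|_E$. Then $\mathsf{Inv}(P)\subset\mathcal{C}(M)$.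
   Context: $M$ carries its Borel $\sigma$-field $\mathcal{B}(M)$; $\mathcal{M}(M)$ (resp. $\mathcal{P}(M)$) is the set of nonnegative finite (resp. probability) Borel measures on $M$. A convex cone of measures is a set $\mathcal{C}(M)\subset\mathcal{M}(M)$ such that $\alpha\mu+\beta\nu\in\mathcal{C}(M)$ for all $\mu,\nu\in\mathcal{C}(M)$, $\alpha,\beta\ge 0$. Saying that $\mathcal{C}(M)$ is a subset of the Banach space $E$ means it is embedded in $E$ so that addition and multiplication by nonnegative scalars of measures in $\mathcal{C}(M)$ coincide with the operations of $E$ (e.g. $\mathcal{C}(M)$ = measures with $C^r$ density on a Riemannian manifold, $E$ = signed measures with $C^r$ density, with the $C^r$ norm of the density). A bounded kernel on $M$ is a family $Q=\{Q(x,\cdot)\}_{x\in M}$ with $Q(x,\cdot)\in\mathcal{M}(M)$, $x\mapsto Q(x,A)$ measurable for every $A\in\mathcal{B}(M)$, and $\sup_x Q(x,M)<\infty$. It is non-degenerate if $Q(x,M)>0$ for all $x$; sub-Markov if $\sup_xQ(x,M)\le 1$; Markov if $Q(x,\cdot)\in\mathcal{P}(M)$ for all $x$; Feller if $f\mapsto Qf(x)=\int f(y)\,Q(x,dy)$ maps $C^0(M)$ into itself. For $\mu\in\mathcal{M}(M)$, $\mu Q(A)=\int\mu(dx)Q(x,A)$; $\Delta^k$ is the $k$-fold composition, $\Delta^0=I$. For $P$ Markov, $\mathsf{Inv}(P)=\{\mu\in\mathcal{P}(M):\mu P=\mu\}$. *)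

(* Defs.v *)
From HB Require Import structures.
From mathcomp Require Import all_boot all_order all_algebra.
From mathcomp Require Import all_classical all_reals all_analysis.

Set Implicit Arguments.
Unset Strict Implicit.
Unset Printing Implicit Defensive.

Import Order.TTheory GRing.Theory Num.Theory.
Import numFieldNormedType.Exports.

Local Open Scope classical_set_scope.
Local Open Scope ring_scope.
Local Open Scope ereal_scope.

(* A [measurableType] has to be pointed, hence so does a metric space that
   carries its Borel sigma-algebra.  This only leaves out the empty space, which
   has no probability measure. *)
#[short(type="pmetricType")]
HB.structure Definition PMetric (K : numDomainType) :=
  {M of Metric K M & Pointed M}.

Notation borel M := (g_sigma_algebraType (@open M)).

(* Measures are functions on all of [set T], whose values on non-measurable sets
   are unconstrained: equality of measures is equality on measurable sets. *)
Definition measure_eq d (T : measurableType d) (R : realType)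
    (mu nu : set T -> \bar R) :=
  forall A, measurable A -> mu A = nu A.

Section linear_combination.
Context d (T : measurableType d) (R : realType).
Variables (a b : {nonneg R}) (mu nu : {finite_measure set T -> \bar R}).

Definition mcomb : set T -> \bar R := measure_add (mscale a mu) (mscale b nu).

HB.instance Definition _ := Measure.on mcomb.

Let mcomb_fin : fin_num_fun mcomb.
Proof.
move=> A mA; rewrite /mcomb measure_addE fin_numD.
by rewrite /= /mscale !fin_numM// fin_num_measure.
Qed.

HB.instance Definition _ := @Measure_isFinite.Build _ T R mcomb mcomb_fin.

End linear_combination.

Section kernel_action.
Context d (T : measurableType d) (R : realType).
Variables (mu : {finite_measure set T -> \bar R}) (K : R.-fker T ~> T).

(* the measure mu K *)
Definition kact (A : set T) : \bar R := \int[mu]_x K x A.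

Let kact0 : kact set0 = 0.
Proof. by apply: integral0_eq => x _; rewrite measure0. Qed.

Let kact_ge0 A : 0 <= kact A.
Proof. by apply: integral_ge0 => x _; exact: measure_ge0. Qed.

Let kact_sigma_additive : semi_sigma_additive kact.
Proof.
move=> F mF tF mUF; rewrite [X in _ --> X](_ : _ =
    \int[mu]_x (\sum_(n <oo) K x (F n))); last first.
  by apply: eq_integral => x _; rewrite measure_semi_bigcup.
rewrite integral_nneseries//; last by move=> n; exact: measurable_kernel.
apply: is_cvg_ereal_nneg_natsum_cond => n _ _; exact: integral_ge0.
Qed.

HB.instance Definition _ :=
  isMeasure.Build _ T R kact kact0 kact_ge0 kact_sigma_additive.

Let kact_fin : fin_num_fun kact.
Proof.
apply: lty_fin_num_fun; have [r Kr] := measure_uub K.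
apply: (@le_lt_trans _ _ (\int[mu]_x r%:E)); last first.
  by rewrite integral_cst// ltey_eq fin_numM// fin_num_measure.
apply: ge0_le_integral => //.
- exact: measurable_kernel.
- by move=> x _; exact/ltW.
Qed.

HB.instance Definition _ := @Measure_isFinite.Build _ T R kact kact_fin.

End kernel_action.

Fixpoint kpow d (T : measurableType d) (R : realType) (D : R.-spker T ~> T)
    (k : nat) : R.-spker T ~> T :=
  if k is k'.+1 then mkcomp_noparam (kpow D k') D
  else kdirac (@measurable_id _ T setT).

Definition nondegenerate_kernel d (T : measurableType d) (R : realType)
    (K : R.-ker T ~> T) :=
  forall x, 0 < K x setT.

Definition feller_kernel (R : realType) (M : pmetricType R)
    (K : R.-ker borel M ~> borel M) :=
  forall f : M -> R, continuous f ->
    continuous (fun x : M => (\int[K x]_y f y)%R : R).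

Definition invariant_probability d (T : measurableType d) (R : realType) (P : R.-pker T ~> T) :
    set (probability T R) :=
  [set mu | measure_eq (kact mu P) mu].

Definition convex_cone d (T : measurableType d) (R : realType)
    (C : set {finite_measure set T -> \bar R}) :=
  (forall mu nu : {finite_measure set T -> \bar R},
     C mu -> measure_eq mu nu -> C nu) /\
  (forall (a b : {nonneg R}) mu nu, C mu -> C nu -> C (mcomb a b mu nu)).

(* [i] realizes the convex cone [C] as a subset of [E]; the values of [i] outside
   of [C] are irrelevant. *)
Definition cone_embedding d (T : measurableType d) (R : realType)
    (E : normedModType R) (C : set {finite_measure set T -> \bar R})
    (i : {finite_measure set T -> \bar R} -> E) :=
  (forall mu nu : {finite_measure set T -> \bar R}, C mu -> C nu ->
     (i mu = i nu <-> measure_eq mu nu)) /\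
  (forall (a b : {nonneg R}) mu nu, C mu -> C nu ->
     i (mcomb a b mu nu) = (a%:num *: i mu + b%:num *: i nu)%R).

(* continuity on [C] of [f] for the distance |i mu - i nu| *)
Definition continuous_on_cone d (T : measurableType d) (R : realType)
    (E : normedModType R) (C : set {finite_measure set T -> \bar R})
    (i : {finite_measure set T -> \bar R} -> E)
    (f : {finite_measure set T -> \bar R} -> R) :=
  forall mu, C mu -> forall e : R, (0 < e)%R ->
    exists2 r : R, (0 < r)%R & forall nu, C nu ->
      (`|i mu - i nu| < r)%R -> (`|f mu - f nu| < e)%R.

(* Main.v *)
(* Feller continuity and compactness give Q(x, M) >= e > 0, hence
   D(x, M) <= 1 - e.  Iterating mu = mu Q + mu D yields
   mu = \sum_(k < n) (mu Q) D^k + mu D^n, where the mass of mu D^n is at most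
   (1 - e)^n.  The partial sums lie in C and converge absolutely in E, so
   their limit is some mu' in C; evaluation on a measurable set being
   continuous on C, mu' = mu. *)
Require Import Defs.
From HB Require Import structures.
From mathcomp Require Import all_boot all_order all_algebra.
From mathcomp Require Import all_classical all_reals all_analysis.
From mathcomp Require Import measurable_realfun.

Set Implicit Arguments.
Unset Strict Implicit.
Unset Printing Implicit Defensive.

Import Order.TTheory GRing.Theory Num.Theory.
Import numFieldNormedType.Exports.

Local Open Scope classical_set_scope.
Local Open Scope ring_scope.
Local Open Scope ereal_scope.

Section constant_kernel.
Context d0 d (S : measurableType d0) (T : measurableType d) (R : realType).
Variable mu : {finite_measure set T -> \bar R}.

(** A measure viewed as a kernel, so that [kact] becomes a composition of kernels and inherits its
    integration formula. *)
Definition kcst (_ : S) : {measure set T -> \bar R} := mu.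

Let kcst_measurable U : measurable U -> measurable_fun [set: S] (kcst ^~ U).
Proof. by move=> mU; exact: measurable_cst. Qed.

HB.instance Definition _ := isKernel.Build _ _ _ _ R kcst kcst_measurable.

Let kcst_uub : measure_fam_uub kcst.
Proof.
exists (fine (mu setT) + 1)%R => x.
by rewrite EFinD fineK ?fin_num_measure// lteDl ?fin_num_measure// lte_fin.
Qed.

HB.instance Definition _ := Kernel_isFinite.Build _ _ _ _ R kcst kcst_uub.

End constant_kernel.

Section second_argument_kernel.
Context d0 d1 d2 (S : measurableType d0) (T : measurableType d1)
  (U : measurableType d2) (R : realType).
Variable K : R.-fker T ~> U.

(** In [kcomp] the second kernel has a product as its source; [K] is given this shape by ignoring
    the first coordinate. *)
Definition ksnd (z : S * T) : {measure set U -> \bar R} := K z.2.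

Let ksnd_measurable A : measurable A -> measurable_fun [set: S * T] (ksnd ^~ A).
Proof.
by move=> mA; exact: measurableT_comp (measurable_kernel K A mA) measurable_snd.
Qed.

HB.instance Definition _ := isKernel.Build _ _ _ _ R ksnd ksnd_measurable.

Let ksnd_uub : measure_fam_uub ksnd.
Proof. by have [r Kr] := measure_uub K; exists r => -[x y]; exact: Kr. Qed.

HB.instance Definition _ := Kernel_isFinite.Build _ _ _ _ R ksnd ksnd_uub.

End second_argument_kernel.

Section kact_theory.
Context {d} {T : measurableType d} {R : realType}.
Implicit Types (mu nu : {finite_measure set T -> \bar R}) (K : R.-fker T ~> T).

Lemma integral_kact mu K (f : T -> \bar R) :
  (forall x, 0 <= f x) -> measurable_fun setT f ->
  \int[kact mu K]_x f x = \int[mu]_x \int[K x]_y f y.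
Proof.
move=> f0 mf.
(* mu K is the composite of K with the kernel constantly equal to mu *)
by rewrite -(integral_kcomp (@kcst _ _ unit _ _ mu)
                            (@ksnd _ _ _ unit _ _ _ K) tt).
Qed.

Lemma eq_kact mu nu K : measure_eq mu nu -> measure_eq (kact mu K) (kact nu K).
Proof.
by move=> mn A mA; apply: eq_measure_integral => B mB _; exact: mn.
Qed.

Lemma kactDl mu nu (xi : {finite_measure set T -> \bar R}) K :
  (forall A, measurable A -> xi A = mu A + nu A) ->
  forall A, measurable A -> kact xi K A = kact mu K A + kact nu K A.
Proof.
move=> xiE A mA; rewrite /kact -ge0_integral_measure_add//.
- apply: eq_measure_integral => B mB _.
  by rewrite -[RHS]/(measure_add mu nu B) measure_addE; exact: xiE.
- exact: measurable_kernel.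
Qed.

Variable D : R.-spker T ~> T.

Lemma kact_kpow0 mu : measure_eq (kact mu (kpow D 0)) mu.
Proof.
move=> A mA; rewrite /kact/= /kdirac.
under eq_integral do rewrite diracE -[X in X%:E]/(\1_A _).
by rewrite integral_indic// setIT.
Qed.

Lemma kact_kpowSr mu k :
  measure_eq (kact mu (kpow D k.+1)) (kact (kact mu (kpow D k)) D).
Proof.
by move=> A mA; rewrite [RHS]integral_kact//; exact: measurable_kernel.
Qed.

(** [kpow] splits off the last factor; splitting off the first one, by induction, is what iterating
    [mu = lam + mu D] requires. *)
Lemma kact_kpowSl mu k :
  measure_eq (kact mu (kpow D k.+1)) (kact (kact mu D) (kpow D k)).
Proof.
elim: k => [|k IH] A mA.
  rewrite kact_kpow0// kact_kpowSr//.
  by apply: eq_kact => //; exact: kact_kpow0.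
by rewrite [RHS]kact_kpowSr// kact_kpowSr//; apply: eq_kact.
Qed.

(** The partial sum of [mu D^k] over [k < n]. The empty sum is written [0 mu + 0 mu], so that it
    lies in a cone containing [mu] and is sent to 0 by the embedding. *)
Fixpoint neumann_sum mu n : {finite_measure set T -> \bar R} :=
  if n is m.+1 then
    @mcomb _ T R 1%:nng%R 1%:nng%R (neumann_sum mu m) (kact mu (kpow D m))
  else @mcomb _ T R 0%:nng%R 0%:nng%R mu mu.

Lemma neumann_sumS mu n A :
  neumann_sum mu n.+1 A = neumann_sum mu n A + kact mu (kpow D n) A.
Proof. by rewrite /= /mcomb measure_addE /= /mscale /= !mul1e. Qed.

(** Induction on [n]: inserting [mu = lam + mu D] into the remainder [mu D^n] yields the next term
    [lam D^n] and the next remainder. *)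
Lemma neumann_sum_decomposition (lam mu : {finite_measure set T -> \bar R}) n :
  (forall A, measurable A -> mu A = lam A + kact mu D A) ->
  forall A, measurable A ->
    mu A = neumann_sum lam n A + kact mu (kpow D n) A.
Proof.
move=> muE A mA; elim: n => [|n IH].
  by rewrite /= /mcomb measure_addE /= /mscale /= !mul0e !add0e kact_kpow0.
rewrite neumann_sumS [LHS]IH -addeA; congr (_ + _).
by rewrite kact_kpowSl//; exact: kactDl.
Qed.

Lemma kact_kpow_mass_le mu (r : R) n : (forall x, D x setT <= r%:E) ->
  kact mu (kpow D n) setT <= (r ^+ n)%:E * mu setT.
Proof.
move=> Dr; have r0 : (0 <= r)%R by rewrite -lee_fin; exact: le_trans (Dr point).
elim: n => [|n IH]; first by rewrite kact_kpow0// expr0 mul1e.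
rewrite kact_kpowSr// {1}/kact.
apply: (@le_trans _ _ (\int[kact mu (kpow D n)]_x r%:E)).
  by apply: ge0_le_integral => // [|x _]; [exact: measurable_kernel|exact: Dr].
by rewrite integral_cst// exprS EFinM -muleA lee_wpmul2l// lee_fin.
Qed.

Context {E : normedModType R} (C : set {finite_measure set T -> \bar R}).
Variable i : {finite_measure set T -> \bar R} -> E.
Hypothesis coneC : convex_cone C.
Hypothesis embC : cone_embedding C i.
Hypothesis CD : forall mu, C mu -> C (kact mu D).

Lemma cone_kact_kpow mu k : C mu -> C (kact mu (kpow D k)).
Proof.
move=> Cmu; elim: k => [|k IH].
  by apply: (coneC.1 _ _ Cmu) => A mA; exact/esym/kact_kpow0.
by apply: (coneC.1 _ _ (CD IH)) => A mA; exact/esym/kact_kpowSr.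
Qed.

Lemma cone_neumann_sum mu n : C mu -> C (neumann_sum mu n).
Proof.
move=> Cmu; elim: n => [|n IH] /=; apply: coneC.2 => //.
exact: cone_kact_kpow.
Qed.

Lemma embedding_neumann_sum mu n : C mu ->
  i (neumann_sum mu n) = series (fun k => i (kact mu (kpow D k))) n.
Proof.
move=> Cmu; elim: n => [|n IH].
  by rewrite /= embC.2// !scale0r addr0 /series/= big_geq.
rewrite [LHS]embC.2 ?scale1r ?IH ?seriesSr//.
  exact: cone_neumann_sum.
exact: cone_kact_kpow.
Qed.

End kact_theory.

(** The mass [Q x setT] is the integral of the constant 1, hence continuous in [x] by the Feller
    property; its minimum over the compact space is attained, and is positive by non-degeneracy. *)
Lemma feller_mass_lower_bound (R : realType) (M : pmetricType R)
    (Q : R.-fker borel M ~> borel M) :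
  compact [set: M] -> feller_kernel Q -> nondegenerate_kernel Q ->
  exists2 e : R, (0 < e)%R & forall x, e%:E <= Q x setT.
Proof.
move=> cM fQ Q0.
have Qfin x : Q x setT \is a fin_num by exact: kernel_finite_transition.
have QE x : (\int[Q x]_y cst 1 y)%R = fine (Q x setT) :> R.
  by rewrite Rintegral_cst// mul1r.
have cQ : continuous (fun x : M => fine (Q x setT) : R).
  under eq_fun do rewrite -QE.
  by apply: fQ; exact: cst_continuous.
have [c _ Qc] := @compact_EVT_min M R _ _ (ex_intro _ point I) cM
  (continuous_subspaceT cQ).
exists (fine (Q c setT)).
  by rewrite fine_gt0// Q0/= ltey_eq Qfin.
by move=> x; rewrite -[leRHS]fineK// lee_fin Qc// inE.
Qed.

Theorem theorem2p8 (R : realType) (M : pmetricType R)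
  (P : R.-pker borel M ~> borel M)
  (Q D : R.-spker borel M ~> borel M)
  (E : completeNormedModType R)
  (C : set {finite_measure set (borel M) -> \bar R})
  (i : {finite_measure set (borel M) -> \bar R} -> E)
  (compactM : compact [set: M])
  (fellerP : feller_kernel P)
  (coneC : convex_cone C)
  (embC : cone_embedding C i)
  (closedC : closed (i @` C))
  (PQD : forall x (A : set (borel M)), measurable A -> P x A = Q x A + D x A)
  (nondegQ : nondegenerate_kernel Q)
  (fellerQ : feller_kernel Q)
  (CQ : forall mu : {finite_measure set (borel M) -> \bar R}, C (kact mu Q))
  (CD : forall mu : {finite_measure set (borel M) -> \bar R},
          C mu -> C (kact mu D))
  (sumD : forall mu : {finite_measure set (borel M) -> \bar R}, C mu ->
     \sum_(0 <= k <oo) (`|i (kact mu (kpow D k))|%R)%:E < +oo)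
  (evalC : forall A : set (borel M), measurable A ->
     continuous_on_cone C i (fun mu => fine (mu A))) :
  forall mu : probability (borel M) R, invariant_probability P mu -> C mu.
Proof.
move=> mu muP.
have muQD A : measurable A -> mu A = kact mu Q A + kact mu D A.
  move=> mA; rewrite -muP// /kact -ge0_integralD//.
  - by apply: eq_integral => x _; rewrite PQD.
  - exact: (measurable_kernel Q).
  - exact: (measurable_kernel D).
have [e e0 Qe] := feller_mass_lower_bound compactM fellerQ nondegQ.
(* Since [P x setT = 1], the mass [e] taken by [Q] is lost to [D]. *)
have De x : D x setT <= (1 - e)%:E.
  rewrite EFinB leeBrDr// -(@prob_kernel _ _ _ _ _ P x) PQD// addeC.
  exact: leeD2r (Qe x).
have r0 : (0 <= 1 - e)%R by rewrite -lee_fin; exact: le_trans (De point).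
(* The expansion starts from [mu Q], which lies in [C] although [mu] is not yet known to. *)
pose lam : {finite_measure set (borel M) -> \bar R} := kact mu Q.
pose nu n := neumann_sum D lam n.
have Cnu n : C (nu n) by exact: (cone_neumann_sum coneC CD n (CQ mu)).
have muE n A : measurable A -> mu A = nu n A + kact mu (kpow D n) A.
  exact: neumann_sum_decomposition.
have nu_mu A : measurable A -> fine (nu n A) @[n --> \oo] --> fine (mu A).
  move=> mA.
  have nuA n : fine (nu n A) = (fine (mu A) - fine (kact mu (kpow D n) A))%R.
    by rewrite (muE n)// fineD ?fin_num_measure// addrK.
  rewrite -[X in _ --> X]subr0.
  under eq_fun do rewrite nuA.
  apply: cvgB; first exact: cvg_cst.
  (* The remainder on [A] is at most its total mass, which decays geometrically because [mu] has
     mass 1. *)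
  apply: (@squeeze_cvgr _ _ _ _ (cst 0%R) (fun n => (1 - e) ^+ n)%R).
  - near=> n; rewrite fine_ge0//= -lee_fin fineK ?fin_num_measure//.
    apply: (@le_trans _ _ (kact mu (kpow D n) setT)).
      by apply: le_measure; rewrite ?inE.
    apply: (le_trans (kact_kpow_mass_le mu n De)).
    by rewrite [X in _ * X](probability_setT mu) mule1.
  - exact: cvg_cst.
  - by apply: cvg_expr; rewrite ger0_norm// gtrBl.
(* Absolute convergence implies convergence since [E] is complete. *)
have inu : cvgn (i \o nu).
  have -> : i \o nu = series (fun k => i (kact lam (kpow D k))).
    apply/funext => n.
    exact: (embedding_neumann_sum coneC embC CD n (CQ mu)).
  apply/normed_cvg/nnseries_is_cvg => [n|]; first exact: normr_ge0.
  exact: sumD (CQ mu).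
have [mu' Cmu' mu'E] : (i @` C) (limn (i \o nu)).
  by apply: (closed_cvg _ closedC _ _ inu); apply: nearW => n; exists (nu n).
(* It suffices that [mu'] and [mu] agree on measurable sets: both values are limits of [nu n A]. *)
apply: (coneC.1 _ _ Cmu') => A mA.
have nu_mu' : fine (nu n A) @[n --> \oo] --> fine (mu' A).
  apply/cvgrPdist_lt => d d0.
  have [r r_gt0 rP] := evalC A mA mu' Cmu' d d0.
  have /cvgrPdist_lt/(_ r r_gt0) : i (nu n) @[n --> \oo] --> i mu'.
    by rewrite mu'E.
  by apply: filterS => n; exact: rP.
rewrite -[LHS]fineK ?fin_num_measure// -[RHS]fineK ?fin_num_measure//.
by congr EFin; exact: cvg_unique nu_mu' (nu_mu A mA).
Unshelve. all: by end_near.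
Qed.
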